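(* Let $I\subset R=\mathbf{k}[x_1,\dots,x_n]$ be a monomial ideal and $a\in\mathbb{N}^n$. If $H_{i,a}(\mathbb{K}(I))\neq 0$ for some $i$, then $x^{a}$ is a (minimal) generator of some node $J$ in any Mayer-Vietoris tree $MVT(I)$ of $I$.
   Context: $\mathbf{k}$ is a field of characteristic $0$, $R=\mathbf{k}[x_1,\dots,x_n]$ with its $\mathbb{N}^n$-grading. Monomial ideals are nonzero. Koszul homology: let $\mathcal{V}$ be the $\mathbf{k}$-vector space with basis $x_1,\dots,x_n$. $\mathbb{K}(I)$ is the complex with modules $I\otimes_{\mathbf{k}}\wedge^i\mathcal{V}$ and differential $\partial(m\otimes x_{j_1}\wedge\cdots\wedge x_{j_i})=\sum_{l=1}^i(-1)^{l+1}x_{j_l}m\otimes x_{j_1}\wedge\cdots\wedge\widehat{x_{j_l}}\wedge\cdots\wedge x_{j_i}$. It is $\mathbb{N}^n$-graded (the multidegree of $x^\mu\otimes x_{j_1}\wedge\cdots\wedge x_{j_i}$ is $\mu+e_{j_1}+\cdots+e_{j_i}$), and $H_{i,a}(\mathbb{K}(I))\cong \mathrm{Tor}^R_{i,a}(I,\mathbf{k})$ is the multidegree-$a$ part of its $i$-th homology. Mayer-Vietoris trees: a Mayer-Vietoris tree $MVT(I)$ of $I$ is a rooted binary tree whose nodes are (labelled by) monomial ideals, with root $I$. Whenever a node $J$ has minimal monomial generating set $\{m_1,\dots,m_s\}$ with $s\geq 2$, one minimal generator (the pivot monomial) is chosen, the choice being arbitrary at each node; numbering so that the pivot is $m_s$,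 the node $J$ has exactly two children: the left child $\tilde J=\langle m_1,\dots,m_{s-1}\rangle\cap\langle m_s\rangle=\langle \mathrm{lcm}(m_1,m_s),\dots,\mathrm{lcm}(m_{s-1},m_s)\rangle$ and the right child $J'=\langle m_1,\dots,m_{s-1}\rangle$. Nodes with a single minimal generator are leaves. *)

(* Defs.v *)
From mathcomp Require Import all_boot all_order all_algebra.
From mathcomp Require Import finmap.
From mathcomp Require Import mpoly.

Set Implicit Arguments.
Unset Strict Implicit.
Unset Printing Implicit Defensive.

Import GRing.Theory.

Local Open Scope fset_scope.
Local Open Scope ring_scope.

(* Ideals are predicates on the polynomial ring; the unit ideal is allowed
   (unlike for the library's [idealr_closed]). *)
Definition ideal (k : fieldType) (n : nat) : Type := {mpoly k[n]} -> Prop.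

Section MonomialIdeals.
Variables (k : fieldType) (n : nat).
Implicit Types (I J : ideal k n) (a m p : 'X_{1..n}) (M : {fset 'X_{1..n}}).

Definition same_ideal I J : Prop := forall f, I f <-> J f.

Definition cap_ideal I J : ideal k n := fun f => I f /\ J f.

(* The ideal generated by the monomials 'X_[m] with [G m]: the finite sums
   \sum_t c_t * 'X_[m_t], where each m_t satisfies G. *)
Definition mon_gen (G : 'X_{1..n} -> Prop) : ideal k n := fun f =>
  exists s : seq ({mpoly k[n]} * 'X_{1..n}),
    (forall t, t \in s -> G t.2) /\ f = \sum_(t <- s) t.1 * 'X_[t.2].

Definition fmon_gen M : ideal k n := mon_gen (fun m => m \in M).

Definition monomial_ideal I : Prop :=
  (exists G : 'X_{1..n} -> Prop, same_ideal I (mon_gen G))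
  /\ exists2 f, I f & f != 0.

Definition minimal_generating_set I M : Prop :=
  same_ideal I (fmon_gen M)
  /\ forall M', M' `<` M -> ~ same_ideal I (fmon_gen M').

Definition minimal_generator I m : Prop :=
  exists2 M, minimal_generating_set I M & m \in M.

End MonomialIdeals.

Section Koszul.
Variables (k : fieldType) (n : nat).

(* R (x) /\V: [z S] is the coefficient of the basis vector
   x_{j_1} /\ ... /\ x_{j_i} of the exterior algebra,
   where S = {j_1 < ... < j_i}. *)
Definition koszul_chain : Type := {ffun {set 'I_n} -> {mpoly k[n]}}.

Implicit Types (I : ideal k n) (z w : koszul_chain) (S T : {set 'I_n}).

Definition elementary (f : {mpoly k[n]}) S : koszul_chain :=
  [ffun T => if T == S then f else 0].

(* For j = j_l in S = {j_1 < ... < j_i}, the number of elements of S smaller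
   than j is l - 1, and (-1)^(l-1) = (-1)^(l+1). *)
Definition koszul_diff z : koszul_chain :=
  \sum_(S : {set 'I_n}) \sum_(j in S)
    elementary ((-1) ^+ #|[set h in S | (h < j)%N]| * ('X_j * z S)) (S :\ j).

(* z lies in the component of I (x) /\^i V of multidegree a. *)
Definition koszul_component I (i : nat) (a : 'X_{1..n}) z : Prop :=
  [/\ forall S, I (z S),
      forall S, #|S| != i -> z S = 0
    & forall S m, m \in msupp (z S) ->
        (m + \big[mnm_add/mnm0]_(j in S) U_(j))%MM = a].

Definition koszul_cycle I i a z : Prop :=
  koszul_component I i a z /\ koszul_diff z = 0.

Definition koszul_boundary I i a z : Prop :=
  exists2 w, koszul_component I i.+1 a w & koszul_diff w = z.

(* H_{i,a}(K(I)), the quotient of the space of cycles by the space of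
   boundaries, is not 0. *)
Definition koszul_homology_neq0 I i a : Prop :=
  exists2 z, koszul_cycle I i a z & ~ koszul_boundary I i a z.

End Koszul.

Section MayerVietorisTrees.
Variables (k : fieldType) (n : nat).

Inductive mvtree : Type :=
| MVLeaf of ideal k n
| MVNode of ideal k n & mvtree & mvtree.

(* [is_MVT J t]: t is a Mayer-Vietoris tree with root J.  The inductive trees
   are all of them: the right child has one minimal generator less than its
   parent and the left child at most that many, so the trees are finite. *)
Inductive is_MVT : ideal k n -> mvtree -> Prop :=
| is_MVT_leaf J M :
    minimal_generating_set J M -> #|` M| = 1%N -> is_MVT J (MVLeaf J)
| is_MVT_node J M p l r :
    minimal_generating_set J M -> (2 <= #|` M|)%N -> p \in M ->
    is_MVT (cap_ideal (fmon_gen (M `\ p)) (fmon_gen [fset p])) l ->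
    is_MVT (fmon_gen (M `\ p)) r ->
    is_MVT J (MVNode J l r).

Fixpoint is_node (J : ideal k n) (t : mvtree) : Prop :=
  match t with
  | MVLeaf K => J = K
  | MVNode K l r => [\/ J = K, is_node J l | is_node J r]
  end.

End MayerVietorisTrees.

(* Main.v *)
Require Import Defs.
From mathcomp Require Import all_boot all_order all_algebra.
From mathcomp Require Import finmap.
From mathcomp Require Import mpoly.
From mathcomp Require Import ring.
From mathcomp Require Import zify.
From Stdlib Require Import Classical.

Set Implicit Arguments.
Unset Strict Implicit.
Unset Printing Implicit Defensive.

Import GRing.Theory.
Local Open Scope ring_scope.

(** The tree is built so that the ideals at the two children and the principal
    ideal of the pivot fit in a Mayer-Vietoris sequence.  If [p] is the pivot
    of a node [J], [J'] its right child and [J' /\ <p>] its left child, then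
    [J = J' + <p>], and the short exact sequence of Koszul complexes
      0 -> K(J' /\ <p>) -> K(J') + K(<p>) -> K(J) -> 0,
    which is multigraded, shows that if [J] has homology in multidegree [a],
    then so does one of [J' /\ <p>], [J'] and [<p>]; this is
    [mayer_vietoris].  The Koszul homology of a principal ideal lives only in
    the multidegree of its generator ([koszul_homology_principal]).  Hence
    either [a = p], a minimal generator of [J] itself, or the homology in
    multidegree [a] passes to a child.  Going down the tree, the worst case is
    a leaf, which is principal, and there [a] is the generator
    ([mvt_node_generator]).

    The long exact sequence is never formed.  A cycle [z] of [K(J)] splits as
    [u + v] with [u] in [K(J')] and [v] in [K(<p>)], since in a fixed
    multidegree each coefficient of [z] is a scalar times one monomial
    ([koszul_component_fsetU]).  The common boundary of [u] and [- v] is a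
    cycle of the intersection; if it bounds [w] there, then [u - w] and [v + w]
    are cycles, and primitives of them add up to a primitive of [z]. *)

(** * Membership in monomial ideals *)

Section IdealMembership.
Variables (k : fieldType) (n : nat).
Implicit Types (I J : ideal k n) (M : {fset 'X_{1..n}}) (f g : {mpoly k[n]}).

Definition is_ideal I : Prop :=
  [/\ I 0, forall f g, I f -> I g -> I (f + g)
    & forall c f, I f -> I (c * f)].

Lemma ideal_opp I f : is_ideal I -> I f -> I (- f).
Proof. by case=> _ _ Imul If; rewrite -mulN1r; exact: Imul. Qed.

Lemma ideal_sum I (T : Type) (r : seq T) (P : pred T) (F : T -> {mpoly k[n]}) :
  is_ideal I -> (forall t, P t -> I (F t)) -> I (\sum_(t <- r | P t) F t).
Proof. by case=> I0 ID _ IF; elim/big_ind: _. Qed.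

Lemma fmon_gen_is_ideal M : is_ideal (fmon_gen (k := k) M).
Proof.
split=> [|f g [s [sM ->]] [t [tM ->]]|c f [s [sM ->]]].
- by exists [::]; rewrite big_nil.
- exists (s ++ t); split; last by rewrite big_cat.
  by move=> x; rewrite mem_cat => /orP[/sM|/tM].
- exists [seq (c * t.1, t.2) | t <- s]; split.
    by move=> _ /mapP[t /sM tM ->].
  by rewrite big_map mulr_sumr; apply: eq_bigr => t _; rewrite mulrA.
Qed.

Lemma fmon_gen_monomial M (g m : 'X_{1..n}) :
  g \in M -> (g <= m)%MM -> fmon_gen (k := k) M 'X_[m].
Proof.
move=> gM le_gm; exists [:: ('X_[(m - g)%MM], g)].
split=> [t|]; first by rewrite inE => /eqP->.
by rewrite big_seq1 -mpolyXD submK.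
Qed.

(** A monomial ideal contains a polynomial exactly when it contains its
    monomials.  The boolean form makes the case distinction on membership in
    [koszul_component_fsetU] available for the definition of a chain. *)
Lemma fmon_genP M f :
  reflect (fmon_gen M f)
    (all (fun m : 'X_{1..n} => has (fun p => p <= m)%MM (M : seq _)) (msupp f)).
Proof.
apply: (iffP allP) => [divM|[s [sM ->]] m].
  rewrite [f]mpolyE big_seq.
  apply: ideal_sum; first exact: fmon_gen_is_ideal.
  move=> m /divM/hasP[g gM le_gm]; rewrite -mul_mpolyC.
  have [_ _ Mmul] := fmon_gen_is_ideal M.
  exact: (Mmul _ _ (fmon_gen_monomial gM le_gm)).
move=> /msupp_sum_le /flatten_mapP[t].
rewrite mem_filter /= => /sM tM; rewrite (perm_mem (msuppMX _ _)).
by case/mapP=> m' _ ->; apply/hasP; exists t.2; rewrite // lem_addr.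
Qed.

Lemma monomial_supported f m :
  {in msupp f, forall m', m' = m} -> f = f@_m *: 'X_[m].
Proof.
move=> suppf; apply/mpolyP => m'; rewrite mcoeffZ mcoeffX.
have [<-|neq] := eqVneq m m'; first by rewrite mulr1.
rewrite mulr0; apply: memN_msupp_eq0; apply/negP => /suppf eq_m.
by rewrite eq_m eqxx in neq.
Qed.

End IdealMembership.

(** * The Koszul differential *)

Section Differential.
Variables (k : fieldType) (n : nat).
Implicit Types (z w : koszul_chain k n) (S T : {set 'I_n}) (a m : 'X_{1..n}).
Implicit Types (I J : ideal k n).

Definition wedge_sign S (j : 'I_n) : {mpoly k[n]} :=
  (-1) ^+ #|[set h in S | (h < j)%N]|.

Lemma wedge_sign_sqr S j : wedge_sign S j * wedge_sign S j = 1.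
Proof. by rewrite /wedge_sign -expr2 sqrr_sign. Qed.

Lemma wedge_signU1 S i j :
  i \notin S -> wedge_sign (i |: S) j = (-1) ^+ (i < j)%N * wedge_sign S j.
Proof.
move=> iS; rewrite /wedge_sign -exprD; congr (_ ^+ _).
have [lt_ij|le_ji] := ltnP i j.
  have -> : [set h in i |: S | (h < j)%N] = i |: [set h in S | (h < j)%N].
    by apply/setP=> h; rewrite !inE andb_orl; case: eqP => // ->; rewrite lt_ij.
  by rewrite cardsU1 inE (negPf iS).
rewrite add0n; apply: eq_card => h; rewrite !inE andb_orl.
by case: eqP => // ->; rewrite ltnNge le_ji.
Qed.

(** This is the relation x_i /\ x_j = - x_j /\ x_i; all sign computations go
    through it. *)
Lemma wedge_sign_anticomm S i j :
  i \notin S -> j \notin S -> i != j ->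
  wedge_sign S i * wedge_sign (i |: S) j
  = - (wedge_sign S j * wedge_sign (j |: S) i).
Proof.
move=> iS jS neq_ij; rewrite !wedge_signU1 //.
have : (i != j :> nat) by [].
by case: ltngtP => //= _ _; rewrite ?expr1 ?expr0; ring.
Qed.

Lemma msupp_wedge_sign S j (f : {mpoly k[n]}) :
  msupp (wedge_sign S j * f) =i msupp f.
Proof.
move=> m; rewrite /wedge_sign -signr_odd.
by case: odd; rewrite ?mulN1r ?mul1r ?(perm_mem (msuppN _)).
Qed.

(** The definition of [koszul_diff] sums over the terms of the source; reading
    off the coefficient at [T] is what the proofs compute with. *)
Lemma koszul_diffE z T :
  koszul_diff z T
  = \sum_(j | j \notin T) wedge_sign T j * ('X_j * z (j |: T)).
Proof.
rewrite /koszul_diff sum_ffunE.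
under eq_bigr => S _ do rewrite sum_ffunE.
rewrite (exchange_big_dep predT) //= [RHS]big_mkcond /=.
apply: eq_bigr => j _; case: ifPn => [jT|].
  rewrite (bigD1 (j |: T)) ?setU11 //= big1 => [|S /andP[jS neqS]].
    rewrite addr0 /elementary ffunE setU1K // eqxx; congr (_ * _).
    by rewrite -/(wedge_sign _ _) wedge_signU1 // ltnn mul1r.
  rewrite /elementary ffunE; case: eqP => // eqT.
  by rewrite eqT setD1K ?eqxx in neqS.
rewrite negbK => jT; rewrite big1 // => S jS; rewrite /elementary ffunE.
by case: eqP => // eqT; rewrite eqT !inE eqxx in jT.
Qed.

Lemma koszul_diffD z w : koszul_diff (z + w) = koszul_diff z + koszul_diff w.
Proof.
apply/ffunP => T; rewrite ffunE !koszul_diffE -big_split.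
by apply: eq_bigr => j _; rewrite ffunE /=; ring.
Qed.

Lemma koszul_diffN z : koszul_diff (- z) = - koszul_diff z.
Proof.
apply/ffunP => T; rewrite ffunE !koszul_diffE -sumrN.
by apply: eq_bigr => j _; rewrite ffunE /=; ring.
Qed.

Lemma koszul_diff0 : koszul_diff (0 : koszul_chain k n) = 0.
Proof.
apply/ffunP=> T; rewrite koszul_diffE ffunE big1 // => j _.
by rewrite ffunE !mulr0.
Qed.

(** The terms with [j < i] cancel those with [i < j], so the sum vanishes even
    when 2 is not invertible. *)
Lemma sum_antisymmetric (V : zmodType) (P : pred 'I_n) (F : 'I_n -> 'I_n -> V) :
  (forall i j, P i -> P j -> i != j -> F i j = - F j i) ->
  \sum_(i | P i) \sum_(j | P j && (j != i)) F i j = 0.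
Proof.
move=> antiF.
under eq_bigr => i _ do rewrite (bigID (fun j : 'I_n => (j < i)%N)) /=.
rewrite big_split /= [X in _ + X](exchange_big_dep P) /=; last first.
  by move=> i j _ /andP[/andP[]].
rewrite -big_split /= big1 // => i Pi.
apply/eqP; rewrite addr_eq0 -sumrN; apply/eqP.
apply: eq_big => [j|j /andP[/andP[Pj neq] _]]; last by rewrite antiF // eq_sym.
rewrite Pi -(inj_eq val_inj) -[i == j](inj_eq val_inj) /=.
by case: (P j) => //=; case: ltngtP.
Qed.

Lemma koszul_diff_diff z : koszul_diff (koszul_diff z) = 0.
Proof.
apply/ffunP => T; rewrite koszul_diffE ffunE.
rewrite -[RHS](@sum_antisymmetric _ (fun i => i \notin T) (fun i j =>
  wedge_sign T i * wedge_sign (i |: T) j * ('X_i * 'X_j * z (j |: (i |: T))))).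
  apply: eq_bigr => i _; rewrite koszul_diffE !mulr_sumr.
  apply: eq_big => [j|j _]; first by rewrite !inE negb_or andbC.
  by ring.
move=> i j iT jT neq; rewrite wedge_sign_anticomm // setUCA.
by ring.
Qed.

Definition exponent S : 'X_{1..n} := \big[mnm_add/mnm0]_(j in S) U_(j)%MM.

Lemma exponentE S h : exponent S h = (h \in S).
Proof.
rewrite /exponent mnm_sumE.
under eq_bigr => j _ do rewrite mnm1E.
have [hS|hS] := boolP (h \in S).
  rewrite (bigD1 h) //= eqxx big1 // => j /andP[_ /negPf ->] //.
by rewrite big1 // => j jS; case: eqP => // eqj; rewrite -eqj jS in hS.
Qed.

Lemma exponentU1 S j :
  j \notin S -> exponent (j |: S) = (U_(j) + exponent S)%MM.
Proof. by move=> jS; rewrite /exponent big_setU1. Qed.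

Lemma koszul_component0 I i a : is_ideal I -> koszul_component I i a 0.
Proof.
case=> I0 _ _; split=> [S|S _|S m]; rewrite ffunE //.
by rewrite msupp0.
Qed.

Lemma koszul_componentD I i a z w : is_ideal I ->
  koszul_component I i a z -> koszul_component I i a w ->
  koszul_component I i a (z + w).
Proof.
case=> _ ID _ [zI zi za] [wI wi wa]; split=> [S|S Si|S m]; rewrite ffunE.
- exact: ID.
- by rewrite zi // wi // addr0.
- by move=> /msuppD_le; rewrite mem_cat => /orP[/za|/wa].
Qed.

Lemma koszul_componentN I i a z : is_ideal I ->
  koszul_component I i a z -> koszul_component I i a (- z).
Proof.
move=> idI [zI zi za]; split=> [S|S Si|S m]; rewrite ffunE.
- exact: ideal_opp.
- by rewrite zi // oppr0.
- by rewrite (perm_mem (msuppN _)) => /za.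
Qed.

Lemma koszul_component_sub I J i a z : (forall f, I f -> J f) ->
  koszul_component I i a z -> koszul_component J i a z.
Proof. by move=> IJ [zI zi za]; split=> // S; exact: IJ. Qed.

Lemma koszul_component_diff I i a z : is_ideal I ->
  koszul_component I i.+1 a z -> koszul_component I i a (koszul_diff z).
Proof.
move=> idI [zI zi za]; have [_ _ IM] := idI.
split=> [T|T Ti|T m]; rewrite koszul_diffE.
- by apply: ideal_sum => // j _; do 2!apply: (IM).
- rewrite big1 // => j jT; rewrite zi ?mulr0 //.
  by rewrite cardsU1 jT add1n eqSS.
move=> /msupp_sum_le /flatten_mapP[j]; rewrite mem_filter => /andP[jT _].
rewrite msupp_wedge_sign ['X_j * _]mulrC.
rewrite (perm_mem (msuppMX _ _)) => /mapP[m' /za <- ->].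
rewrite -/(exponent _) -/(exponent _) exponentU1 //.
by rewrite addmA [(_ + m')%MM]addmC.
Qed.

Lemma koszul_diff_degree0 I a z :
  koszul_component I 0 a z -> koszul_diff z = 0.
Proof.
case=> _ z0 _; apply/ffunP => T; rewrite koszul_diffE ffunE big1 // => j jT.
by rewrite z0 ?mulr0 // cardsU1 jT.
Qed.

Lemma koszul_homology_same I J i a : same_ideal I J ->
  koszul_homology_neq0 I i a -> koszul_homology_neq0 J i a.
Proof.
move=> sIJ [z [zI dz] zB]; exists z.
  by split=> //; apply: koszul_component_sub zI => f /sIJ.
case=> w wJ dw; apply: zB; exists w => //.
by apply: koszul_component_sub wJ => f /sIJ.
Qed.

End Differential.

(** * Mayer-Vietoris for Koszul homology *)

Section MayerVietoris.
Variables (k : fieldType) (n : nat).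
Implicit Types (z w : koszul_chain k n) (S T : {set 'I_n}) (a m : 'X_{1..n}).
Implicit Types (M : {fset 'X_{1..n}}).

Lemma koszul_component_homog (I : ideal k n) i a z S :
  koszul_component I i a z ->
  z S = (z S)@_(a - exponent S) *: 'X_[(a - exponent S)%MM].
Proof.
case=> _ _ za; apply: monomial_supported => m /za <-.
by rewrite -/(exponent S) addmK.
Qed.

(** In multidegree [a] each coefficient of [z] involves a single monomial, and
    a monomial in a sum of two monomial ideals lies in one of them. *)
Lemma koszul_component_fsetU M1 M2 i a z :
  koszul_component (fmon_gen (M1 `|` M2)%fset) i a z ->
  exists u v, [/\ koszul_component (fmon_gen M1) i a u,
                  koszul_component (fmon_gen M2) i a v & z = u + v].
Proof.
move=> zM; have [zI zi za] := zM.
pose divM M (m : 'X_{1..n}) := has (fun g => g <= m)%MM (M : seq _).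
pose inM1 S := all (divM M1) (msupp (z S)).
exists [ffun S => if inM1 S then z S else 0].
exists [ffun S => if inM1 S then 0 else z S]; split.
- split=> [S|S Si|S m]; rewrite ffunE.
  + by case: ifP => [/fmon_genP //|_]; case: (fmon_gen_is_ideal k M1).
  + by rewrite zi ?if_same.
  + by case: ifP => _; [exact: za | rewrite msupp0].
- split=> [S|S Si|S m]; rewrite ffunE.
  + case: ifPn => [_|nM1]; first by case: (fmon_gen_is_ideal k M2).
    apply/fmon_genP/allP => m mS; case/allPn: nM1 => m1 m1S nM1.
    (* The multidegree leaves one monomial, so a monomial missed by [M1] is all
       of [z S]. *)
    have eqm : m = m1.
      by apply: (@addIm _ (exponent S)); rewrite /exponent (za S m) ?(za S m1).
    case/fmon_genP/allP/(_ m mS)/hasP: (zI S) => g.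
    rewrite in_fsetU => /orP[gM1|gM2] le_gm; last by apply/hasP; exists g.
    by case/negP: nM1; rewrite -eqm; apply/hasP; exists g.
  + by rewrite zi ?if_same.
  + by case: ifP => _; [rewrite msupp0 | exact: za].
- by apply/ffunP => S; rewrite !ffunE; case: ifP; rewrite ?addr0 ?add0r.
Qed.

Lemma koszul_boundary_of_homology0 (I : ideal k n) i a z :
  ~ koszul_homology_neq0 I i a -> koszul_cycle I i a z ->
  koszul_boundary I i a z.
Proof. by move=> H0 zI; apply: NNPP => zB; apply: H0; exists z. Qed.

(** Exactness of the Mayer-Vietoris sequence at the homology of the sum: if the
    other three groups vanish, the boundary [koszul_diff u] of one part of a
    cycle [z = u + v] can be corrected to zero inside the intersection. *)
Lemma mayer_vietoris M1 M2 i a :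
  koszul_homology_neq0 (fmon_gen (k := k) (M1 `|` M2)%fset) i a ->
  [\/ exists j, koszul_homology_neq0
                  (cap_ideal (fmon_gen (k := k) M1) (fmon_gen M2)) j a,
      koszul_homology_neq0 (fmon_gen (k := k) M1) i a
    | koszul_homology_neq0 (fmon_gen (k := k) M2) i a].
Proof.
move=> HU.
have [?|H12] := classic (exists j, koszul_homology_neq0
  (cap_ideal (fmon_gen (k := k) M1) (fmon_gen M2)) j a); first by constructor 1.
have [?|H1] := classic (koszul_homology_neq0 (fmon_gen (k := k) M1) i a).
  by constructor 2.
have [?|H2] := classic (koszul_homology_neq0 (fmon_gen (k := k) M2) i a).
  by constructor 3.
exfalso; case: HU => z [zU dz]; apply.
have [u [v [uM1 vM2 zE]]] := koszul_component_fsetU zU.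
have id1 := fmon_gen_is_ideal k M1; have id2 := fmon_gen_is_ideal k M2.
have duv : koszul_diff u = - koszul_diff v.
  by apply/eqP; rewrite -addr_eq0 -koszul_diffD -zE dz.
have [w [w1 w2 dw]] : exists w, [/\ koszul_component (fmon_gen M1) i a w,
    koszul_component (fmon_gen M2) i a w & koszul_diff w = koszul_diff u].
  case: i => [|i] in zU uM1 vM2 H1 H2 *.
    (* In homological degree 0 there is nothing to correct. *)
    exists 0; rewrite koszul_diff0 (koszul_diff_degree0 uM1).
    by split=> //; exact: koszul_component0.
  have H12i H := H12 (ex_intro _ i H).
  have [|w w12 dw] := koszul_boundary_of_homology0 H12i (z := koszul_diff u).
    split; last exact: koszul_diff_diff.
    have [du1 dui dua] := koszul_component_diff id1 uM1.
    split=> // S; split=> //.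
    rewrite duv ffunE; apply: ideal_opp => //.
    by have [] := koszul_component_diff id2 vM2.
  by exists w; split=> //; apply: koszul_component_sub w12 => f [].
have [|b1 b1M db1] := koszul_boundary_of_homology0 H1 (z := u - w).
  split; first by apply: koszul_componentD => //; exact: koszul_componentN.
  by rewrite koszul_diffD koszul_diffN dw subrr.
have [|b2 b2M db2] := koszul_boundary_of_homology0 H2 (z := v + w).
  split; first exact: koszul_componentD.
  by rewrite koszul_diffD dw duv subrr.
have subU M M' : {subset M <= M'} ->
    forall f : {mpoly k[n]}, fmon_gen M f -> fmon_gen M' f.
  by move=> sM f [s [sMs ->]]; exists s; split=> // t /sMs/sM.
exists (b1 + b2); last by rewrite koszul_diffD db1 db2 zE addrACA addNr addr0.
apply: koszul_componentD; first exact: fmon_gen_is_ideal.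
  by apply: koszul_component_sub b1M; apply: subU => m; rewrite in_fsetU => ->.
apply: koszul_component_sub b2M; apply: subU => m.
by rewrite in_fsetU orbC => ->.
Qed.

(** * Koszul homology of principal ideals *)

(** Wedging with x_h and dividing by the variable is a contracting homotopy
    wherever the division makes sense.  At [h |: T0], the sign rule turns 'X_h
    times the coefficient of [koszul_diff w] into, up to sign, the part of
    [koszul_diff z T0] with indices other than [h]; as [z] is a cycle, that
    part is minus the remaining term, and 'X_h cancels. *)
Lemma koszul_diff_contraction h z w : koszul_diff z = 0 ->
  (forall T, h \notin T -> w T = 0) ->
  (forall T, h \notin T -> 'X_h * w (h |: T) = wedge_sign k T h * z T) ->
  koszul_diff w = z.
Proof.
move=> dz w0 Xw; apply/ffunP => T; rewrite koszul_diffE.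
have [hT|hT] := boolP (h \in T); last first.
  (* Only the index [h] leads from [T] into the support of [w]. *)
  rewrite (bigD1 h) //= big1 => [|j /andP[jT neq]].
    by rewrite addr0 Xw // mulrA wedge_sign_sqr mul1r.
  by rewrite w0 ?mulr0 // !inE negb_or eq_sym neq.
have Xh_neq0 : 'X_h != 0 :> {mpoly k[n]}.
  apply/eqP => /(congr1 (mcoeff U_(h)%MM))/eqP.
  by rewrite mcoeffX eqxx mcoeff0 oner_eq0.
apply: (mulfI Xh_neq0).
have [T0 hT0 ->] : exists2 T0 : {set 'I_n}, h \notin T0 & T = h |: T0.
  by exists (T :\ h); rewrite ?setD11 ?setD1K.
move/ffunP/(_ T0): dz; rewrite koszul_diffE ffunE (bigD1 h) //=.
move/eqP; rewrite addr_eq0 => /eqP dzT0.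
rewrite -[RHS]mul1r -(wedge_sign_sqr k T0 h) -mulrA dzT0 mulrN -mulrN -sumrN.
rewrite !mulr_sumr; apply: eq_big => [j|j].
  by rewrite !inE negb_or andbC.
rewrite !inE negb_or => /andP[neq jT0].
have sgn : wedge_sign k (h |: T0) j * wedge_sign k (j |: T0) h
    = - (wedge_sign k T0 h * wedge_sign k T0 j).
  have neq_hj : h != j by rewrite eq_sym.
  have eq_sgn := wedge_sign_anticomm k hT0 jT0 neq_hj.
  rewrite -[LHS]mul1r -(wedge_sign_sqr k T0 h).
  transitivity (wedge_sign k T0 h
    * (wedge_sign k T0 h * wedge_sign k (h |: T0) j)
    * wedge_sign k (j |: T0) h); first by ring.
  rewrite eq_sgn -[in RHS](mulr1 (_ * _)) -(wedge_sign_sqr k (j |: T0) h).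
  by ring.
transitivity (wedge_sign k (h |: T0) j * ('X_j * ('X_h * w (h |: (j |: T0))))).
  by rewrite setUCA; ring.
rewrite Xw ?inE ?negb_or 1?eq_sym ?neq //.
transitivity (wedge_sign k (h |: T0) j * wedge_sign k (j |: T0) h
  * ('X_j * z (j |: T0))); first by ring.
by rewrite sgn; ring.
Qed.

Lemma koszul_component_principal_le m i a z S :
  koszul_component (fmon_gen [fset m]%fset) i a z -> z S != 0 ->
  (m + exponent S <= a)%MM.
Proof.
case=> zI _ za; rewrite -msupp_eq0.
case E: (msupp (z S)) => [//|m' s] _.
have m'S : m' \in msupp (z S) by rewrite E mem_head.
suff le_mm : (m <= m')%MM.
  rewrite -(za _ _ m'S); apply/mnm_lepP => j; rewrite !mnmDE leq_add2r.
  exact/mnm_lepP.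
case/fmon_genP/allP/(_ _ m'S)/hasP: (zI S) => g.
by rewrite inE => /eqP->.
Qed.

(** When the exponent of x_h is larger in [a] than in [m], every nonzero
    coefficient of [z] away from [h] is a scalar times a multiple of 'X_[m] x_h,
    so that dividing it by x_h stays inside the principal ideal. *)
Lemma koszul_contraction_principal m i a z h :
  (m h < a h)%N -> koszul_component (fmon_gen [fset m]%fset) i a z ->
  exists w, [/\ koszul_component (fmon_gen [fset m]%fset) i.+1 a w,
    forall T, h \notin T -> w T = 0
    & forall T, h \notin T -> 'X_h * w (h |: T) = wedge_sign k T h * z T].
Proof.
move=> lt_h zM; have [_ zi _] := zM.
have [_ _ IM] := fmon_gen_is_ideal k [fset m]%fset.
(* [c T] is the scalar in front of the only monomial that multidegree [a]
   allows in [z T]. *)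
pose c T := (z T)@_(a - exponent T).
pose w : koszul_chain k n := [ffun S : {set 'I_n} => if h \in S then
  wedge_sign k S h * (c (S :\ h) *: 'X_[(a - exponent S)%MM]) else 0].
have room T : h \notin T -> z T != 0 -> (m + exponent (h |: T) <= a)%MM.
  move=> hT /(koszul_component_principal_le zM)/mnm_lepP le_T.
  apply/mnm_lepP => j; move: (le_T j); rewrite !mnmDE !exponentE !inE.
  by case: (eqVneq j h) => [->|_ //] _; rewrite /= addn1.
have wU T : h \notin T ->
    w (h |: T) = wedge_sign k T h * (c T *: 'X_[(a - exponent (h |: T))%MM]).
  by move=> hT; rewrite ffunE setU11 setU1K // wedge_signU1 // ltnn mul1r.
have wsupp S : w S != 0 -> exists T, [/\ h \notin T, z T != 0 & S = h |: T].
  rewrite ffunE; case: ifPn => [hS|_]; last by rewrite eqxx.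
  move=> nz; exists (S :\ h); rewrite setD11 setD1K //; split=> //.
  by apply: contraNneq nz => z0; rewrite /c z0 mcoeff0 scale0r mulr0.
exists w; split=> [|T hT|T hT]; first split=> [S|S Si|S m'].
- have [->|/wsupp[T [hT zT ->]]] := eqVneq (w S) 0.
    by case: (fmon_gen_is_ideal k [fset m]%fset).
  rewrite wU // -mul_mpolyC; do 2!apply: (IM).
  apply: fmon_gen_monomial (fset11 m) _; apply/mnm_lepP => j.
  by move/mnm_lepP/(_ j): (room T hT zT); rewrite mnmDE mnmBE; lia.
- apply/eqP; apply: contraNT Si => /wsupp[T [hT zT ->]].
  rewrite cardsU1 hT add1n eqSS.
  by apply: contraNT zT => /zi ->.
- have [->|/wsupp[T [hT zT ->]]] := eqVneq (w S) 0; first by rewrite msupp0.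
  rewrite wU // msupp_wedge_sign => /msuppZ_le.
  rewrite msuppX inE => /eqP->; rewrite -/(exponent _) submK //.
  exact: lepm_trans (lem_addl _ _) (room _ hT zT).
- by rewrite ffunE (negPf hT).
rewrite wU // mulrCA; congr (_ * _).
have [zT|zT] := eqVneq (z T) 0; first by rewrite /c zT mcoeff0 scale0r mulr0.
rewrite [RHS](koszul_component_homog T zM) -scalerAr -mpolyXD.
congr (_ *: 'X_[_]); apply/mnmP => j; move/mnm_lepP/(_ j): (room T hT zT).
rewrite !mnmDE mnm1E !mnmBE !exponentE !inE [h == j]eq_sym.
by have [->|_] := eqVneq j h; rewrite ?(negPf hT) /= ?add0n //; lia.
Qed.

(** A principal monomial ideal is a free module of rank one, so its Koszul
    homology sits in the multidegree of the generator: in any other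
    multidegree [a] with nonzero chains, [a] exceeds [m] in some
    coordinate [h], and contraction along [h] bounds every cycle. *)
Lemma koszul_homology_principal m i a :
  koszul_homology_neq0 (fmon_gen (k := k) [fset m]%fset) i a -> a = m.
Proof.
case=> z [zM dz] zB; apply: NNPP => neq_am; apply: zB.
have [->|nz] := eqVneq z 0.
  exists 0; last exact: koszul_diff0.
  exact: koszul_component0 (fmon_gen_is_ideal k _).
have [h lt_h] : exists h, (m h < a h)%N.
  have [S zS] : exists S, z S != 0.
    apply/existsP; apply: contraNT nz => /existsPn z0.
    by apply/eqP/ffunP => S; rewrite ffunE; apply/eqP/negPn/z0.
  apply/existsP; apply: contra_notT neq_am => /existsPn ge_h.
  apply/mnmP => h; apply/eqP; rewrite eqn_leq leqNgt ge_h /=.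
  move/mnm_lepP/(_ h): (koszul_component_principal_le zM zS).
  by rewrite mnmDE; exact: leq_trans (leq_addr _ _).
have [w [wM w0 Xw]] := koszul_contraction_principal lt_h zM.
by exists w => //; exact: koszul_diff_contraction Xw.
Qed.

(** * Descent in the tree *)

Lemma mvt_node_generator (I : ideal k n) (t : mvtree k n) i a :
  is_MVT I t -> koszul_homology_neq0 I i a ->
  exists2 J : ideal k n, is_node J t & minimal_generator J a.
Proof.
move=> It; elim: It i => {I t} [J M JM M1|J M p l r JM _ pM _ IHl _ IHr] i HJ.
  move/eqP/cardfs1P: M1 => [m eqM]; exists J => //; exists M => //.
  have := koszul_homology_same JM.1 HJ; rewrite eqM.
  by move=> /koszul_homology_principal ->; rewrite inE.
have : koszul_homology_neq0
    (fmon_gen (k := k) ((M `\ p) `|` [fset p])%fset) i a.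
  by rewrite fsetUC fsetD1K //; exact: koszul_homology_same JM.1 HJ.
case/mayer_vietoris => [[j Hl]|Hr|/koszul_homology_principal ->].
- by have [K Kl Ka] := IHl _ Hl; exists K => //; constructor 2.
- by have [K Kr Ka] := IHr _ Hr; exists K => //; constructor 3.
- by exists J; [constructor 1 | exists M].
Qed.

End MayerVietoris.

Theorem proposition3p1p6 (k : fieldType) (k_char0 : [pchar k] =i pred0)
    (n : nat) (I : ideal k n) (I_monomial : monomial_ideal I)
    (a : 'X_{1..n}) (nontrivial : exists i : nat, koszul_homology_neq0 I i a)
    (t : mvtree k n) (t_MVT : is_MVT I t) :
  exists2 J : ideal k n, is_node J t & minimal_generator J a.
Proof. by case: nontrivial => i; exact: mvt_node_generator. Qed.
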